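(* Let $G$ be a finite connected even graph, let $\mathcal{C}$ be a cycle decomposition of $G$, and let $CI(G)$ be the cycle intersection graph of $G$ with respect to $\mathcal{C}$. Then $\nabla(G)\leq |E(CI(G))|$.
   Context: An even graph is a graph in which every vertex has even degree (multiple edges are allowed). A cycle decomposition of $G$ is a collection of cycles of $G$ whose edge sets partition $E(G)$. The cycle intersection graph $CI(G)$ with respect to a cycle decomposition $\mathcal{C}$ is the (multi)graph whose vertex set is $\mathcal{C}$ and which has, for each pair of distinct cycles $C,C'\in\mathcal{C}$ and each vertex $v\in V(C)\cap V(C')$, one edge joining $C$ and $C'$ (corresponding to $v$). A decycling set of $G$ is a set $S\subseteq V(G)$ such that $G\setminus S$ is acyclic; the decycling number $\nabla(G)$ is the minimum size of a decycling set of $G$.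
   Formalization: The cycle decomposition is additionally assumed not to consist of exactly one cycle; if G is itself a single cycle, CI(G) has no edges while the decycling number is 1, so the claim fails. *)

(* Defs.v *)
From HB Require Import structures.
From mathcomp Require Import all_boot.

Set Implicit Arguments.
Unset Strict Implicit.
Unset Printing Implicit Defensive.

(* Finite loopless multigraphs: parallel edges are distinct elements of [edge]
   with the same set of ends. *)
Record mgraph := MGraph {
  vertex : finType;
  edge : finType;
  ends : edge -> {set vertex};
  card_ends : forall e, #|ends e| = 2
}.

Definition degree (G : mgraph) (v : vertex G) : nat :=
  #|[set e : edge G | v \in ends e]|.

Definition even_graph (G : mgraph) : Prop :=
  forall v : vertex G, ~~ odd (degree v).

Definition adjacent (G : mgraph) : rel (vertex G) :=
  fun u v => [exists e : edge G, ends e == [set u; v]].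

Definition connected (G : mgraph) : Prop :=
  forall u v : vertex G, connect (@adjacent G) u v.

(* A cycle is represented by its edge set F, whose cardinality k is then its
   length: F = {e_0, ..., e_(k-1)} where e_i joins v_i and v_(i+1 mod k) and the
   v_i are pairwise distinct.  Two parallel edges form a cycle (k = 2). *)
Definition is_cycle (G : mgraph) (F : {set edge G}) : bool :=
  (1 < #|F|) &&
  [exists v : {ffun 'I_#|F| -> vertex G}, exists e : {ffun 'I_#|F| -> edge G},
    [&& injectiveb v, injectiveb e,
        [forall i, ends (e i) == [set v i; v (ordS i)]]
      & F == [set e i | i : 'I_#|F|]]].

Definition cycle_vertices (G : mgraph) (F : {set edge G}) : {set vertex G} :=
  \bigcup_(e in F) ends e.

Definition cycle_decomposition (G : mgraph) (C : {set {set edge G}}) : Prop :=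
  (forall F, F \in C -> is_cycle F) /\ partition C [set: edge G].

Section CycleIntersectionGraph.

Variables (G : mgraph) (C : {set {set edge G}}).

Definition ci_vertex : finType := {F : {set edge G} | F \in C}.

(* An edge is a pair ({F, F'}, v) with F != F' in C and v a common vertex. *)
Definition ci_edge : finType :=
  {p : {set ci_vertex} * vertex G
     | (#|p.1| == 2) && [forall F in p.1, p.2 \in cycle_vertices (val F)]}.

Definition ci_ends (p : ci_edge) : {set ci_vertex} := (val p).1.

Lemma card_ci_ends (p : ci_edge) : #|ci_ends p| = 2.
Proof. by case/andP: (valP p) => /eqP. Qed.

Definition cycle_intersection_graph : mgraph := MGraph card_ci_ends.

End CycleIntersectionGraph.

Section VertexDeletion.

Variables (G : mgraph) (S : {set vertex G}).

Definition del_vertex : finType := {v : vertex G | v \notin S}.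

Definition del_edge : finType := {e : edge G | [disjoint ends e & S]}.

Definition del_ends (e : del_edge) : {set del_vertex} :=
  [set x : del_vertex | val x \in ends (val e)].

Lemma card_del_ends (e : del_edge) : #|del_ends e| = 2.
Proof.
rewrite -(card_ends (val e)) -(card_imset _ val_inj); apply: eq_card => v.
apply/imsetP/idP => [[x xe ->]|ve]; first by rewrite inE in xe.
have vS : v \notin S by rewrite (disjointFr (valP e) ve).
by exists (Sub v vS); rewrite ?inE SubK.
Qed.

Definition delete_vertices : mgraph := MGraph card_del_ends.

End VertexDeletion.

Definition acyclic (G : mgraph) : bool :=
  [forall F : {set edge G}, ~~ is_cycle F].

Definition decycling_set (G : mgraph) (S : {set vertex G}) : bool :=
  acyclic (delete_vertices S).

(* The minimum below ranges over a nonempty family. *)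
Lemma decycling_setT (G : mgraph) : decycling_set [set: vertex G].
Proof.
apply/forallP => F; apply/negP => /andP[F1 _].
have /card_gt0P[e _] := ltnW F1.
have /card_gt0P[x _] : 0 < #|ends e| by rewrite card_ends.
by have := valP x; rewrite inE.
Qed.

Definition decycling_number (G : mgraph) : nat :=
  #|[arg min_(S < [set: vertex G] | decycling_set S) #|S|]|.

(* Main.v *)
(** Delete the set [S] of all vertices lying on at least two cycles of [C]; each
    of them labels an edge of [CI(G)], so [S] is no larger than [E(CI(G))].
    If a cycle survives in [G - S], each of its vertices lies on a single cycle
    of [C] and hence has degree 2 in [G], so by connectedness the cycle visits
    every vertex.  Then [S] is empty, the members of [C] are pairwise disjoint,
    and connectedness again leaves just one of them, contrary to [#|C| <> 1]. *)
Require Import Defs.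
From HB Require Import structures.
From mathcomp Require Import all_boot.

Lemma ordS_neq (n : nat) (i : 'I_n) : 1 < n -> ordS i != i.
Proof.
move=> n_gt1; apply/eqP => /(congr1 val) /= Si.
have := ltn_ord i; rewrite leq_eqVlt => /orP[/eqP Sin|Sin]; last first.
  by move: Si; rewrite modn_small // => /eqP; rewrite gtn_eqF.
by move: n_gt1; rewrite -Sin -{1}Si Sin modnn.
Qed.

Lemma mem_cycle_vertices {G : mgraph} {F : {set edge G}} {e : edge G}
    {x : vertex G} : e \in F -> x \in ends e -> x \in cycle_vertices F.
Proof. by move=> eF xe; apply/bigcupP; exists e. Qed.

(** At the vertex [v i] the cycle arrives along [e (ord_pred i)] and leaves along [e i]; these edges
    differ because the length exceeds 1. *)
Lemma is_cycle_degree {G : mgraph} {F : {set edge G}} {x : vertex G} :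
  is_cycle F -> x \in cycle_vertices F ->
  #|[set e in F | x \in ends e]| = 2.
Proof.
case/andP => F_gt1 /existsP[v /existsP[e]].
case/and4P => /injectiveP v_inj /injectiveP e_inj /forallP ends_e /eqP F_eq.
(* The index type ['I_#|F|] itself depends on [F], so the equation is used only through
   membership. *)
have {F_eq} defF g : (g \in F) = (g \in [set e i | i : 'I_#|F|]) by rewrite {1}F_eq.
move=> /bigcupP[f fF xf].
have [i def_x] : exists i, x = v i.
  move: fF xf; rewrite defF => /imsetP[j _ ->]; rewrite (eqP (ends_e j)).
  by case/set2P => ->; [exists j | exists (ordS j)].
suff -> : [set e in F | x \in ends e] = [set e i; e (ord_pred i)].
  rewrite cards2 (inj_eq e_inj).
  by have := @ordS_neq _ (ord_pred i) F_gt1; rewrite ord_predK => ->.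
apply/setP => g; rewrite !inE def_x; apply/andP/orP.
  rewrite defF; case=> /imsetP[j _ ->].
  rewrite (eqP (ends_e j)) => /set2P[/v_inj->|/v_inj->]; first by left.
  by right; rewrite ordSK.
have eF j : e j \in F by rewrite defF imset_f.
by case=> /eqP->; rewrite eF (eqP (ends_e _)) !inE ?ord_predK eqxx ?orbT.
Qed.

Lemma connected_closed {G : mgraph} {A : {set vertex G}} {x : vertex G} :
  connected G -> x \in A ->
  (forall (e : edge G) u w,
     u \in A -> u \in ends e -> w \in ends e -> w \in A) ->
  forall y, y \in A.
Proof.
move=> G_conn xA A_closed y; have /connectP[p] := G_conn x y.
elim: p x xA => [|z p IHp] x xA /=; first by move=> _ ->.
case/andP => /existsP[e /eqP ends_e]; apply: IHp.
by apply: (A_closed e x z xA); rewrite ends_e !inE eqxx ?orbT.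
Qed.

Definition branch_vertices {G : mgraph} (C : {set {set edge G}}) :
    {set vertex G} :=
  [set x | [exists F1 in C, exists F2 in C,
     [&& F1 != F2, x \in cycle_vertices F1 & x \in cycle_vertices F2]]].

Lemma notin_branch {G : mgraph} {C : {set {set edge G}}}
    {F1 F2 : {set edge G}} {x : vertex G} :
  x \notin branch_vertices C -> F1 \in C -> F2 \in C ->
  x \in cycle_vertices F1 -> x \in cycle_vertices F2 -> F1 = F2.
Proof.
move=> xS F1C F2C xF1 xF2; apply: contraNeq xS => F12; rewrite inE.
by apply/exists_inP; exists F1 => //; apply/exists_inP; exists F2 => //; apply/and3P.
Qed.

Lemma card_branch_vertices (G : mgraph) (C : {set {set edge G}}) :
  #|branch_vertices C| <= #|edge (cycle_intersection_graph C)|.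
Proof.
rewrite -cardsT.
(* The map sending each edge of CI(G) to its label has every branch vertex in its image. *)
apply: leq_trans (leq_imset_card (fun p : ci_edge C => (val p).2) _).
apply/subset_leq_card/subsetP => x; rewrite inE.
case/exists_inP => F1 F1C /exists_inP[F2 F2C /and3P[F12 xF1 xF2]].
pose c1 : ci_vertex C := Sub F1 F1C; pose c2 : ci_vertex C := Sub F2 F2C.
have c12P : (#|[set c1; c2]| == 2) &&
    [forall F in [set c1; c2], x \in cycle_vertices (val F)].
  rewrite cards2 -val_eqE F12 /=.
  by apply/forall_inP => c /set2P[]->.
by apply/imsetP; exists (Sub ([set c1; c2], x) c12P); rewrite ?inE ?SubK.
Qed.

Section Decomposition.

Variables (G : mgraph) (C : {set {set edge G}}).
Hypothesis C_decomp : cycle_decomposition C.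

Lemma decomposition_cover (e : edge G) : exists2 F, F \in C & e \in F.
Proof.
have [_ /and3P[/eqP covC _ _]] := C_decomp.
have : e \in cover C by rewrite covC inE.
by case/bigcupP => F FC eF; exists F.
Qed.

(** All edges at [x] lie in the only member of [C] through [x], which has just two edges there. An
    isolated vertex has degree 0, hence an inequality. *)
Lemma degree_notin_branch (x : vertex G) :
  x \notin branch_vertices C -> degree x <= 2.
Proof.
move=> xS; rewrite /degree.
case: (set_0Vmem [set e | x \in ends e]) => [->|[e]]; first by rewrite cards0.
rewrite inE => xe; have [F FC eF] := decomposition_cover e.
have xF := mem_cycle_vertices eF xe.
rewrite -(is_cycle_degree (C_decomp.1 F FC) xF).
apply/subset_leq_card/subsetP => g; rewrite !inE => xg.
have [F' F'C gF'] := decomposition_cover g.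
have xF' := mem_cycle_vertices gF' xg.
by rewrite xg (notin_branch xS FC F'C xF xF') gF'.
Qed.

Hypothesis G_connected : connected G.

Lemma surviving_cycle_no_branch
    (F : {set edge (delete_vertices (branch_vertices C))}) :
  is_cycle F -> branch_vertices C = set0.
Proof.
move=> F_cycle; pose A := [set val x | x in cycle_vertices F].
have AS u : u \in A -> u \notin branch_vertices C.
  by case/imsetP => x _ ->; exact: (valP x).
have A_closed (e : edge G) u w :
    u \in A -> u \in ends e -> w \in ends e -> w \in A.
  move=> uA ue we; have uS := AS u uA; case/imsetP: uA => x xF def_u.
  (* The two edges of [F] at [x], seen in [G], already exhaust the degree of [u]; so the edge [e]
     comes from [F], and its other end stays in [A]. *)
  pose Fx := [set val f | f in [set f in F | x \in ends f]].
  have Fx2 : #|Fx| = 2.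
    by rewrite card_imset; [exact: is_cycle_degree F_cycle xF | exact: val_inj].
  have sFx : Fx \subset [set g | u \in ends g].
    apply/subsetP => _ /imsetP[f + ->]; rewrite !inE => /andP[_].
    by rewrite def_u.
  have : e \in Fx.
    have /eqP -> : Fx == [set g | u \in ends g].
      by rewrite eqEcard sFx Fx2; apply: degree_notin_branch.
    by rewrite inE.
  case/imsetP => f; rewrite inE => /andP[fF _] def_e.
  have wS : w \notin branch_vertices C.
    by rewrite (disjointFr (valP f)) // -def_e.
  apply/imsetP; exists (Sub w wS); last by rewrite SubK.
  by apply: (mem_cycle_vertices fF); rewrite inE SubK -def_e.
have [x xA] : exists x, x \in A.
  have /andP[/ltnW/card_gt0P[f fF] _] := F_cycle.
  have /card_gt0P[x xf] : 0 < #|ends f| by rewrite card_ends.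
  by exists (val x); apply/imset_f/(mem_cycle_vertices fF).
(* By connectedness [A] contains every vertex, while it avoids the branch vertices. *)
apply/setP => y; rewrite in_set0; apply/negbTE/AS.
exact: (connected_closed G_connected xA A_closed).
Qed.

(** An edge at a vertex of [F1] lies in the only member through that vertex, namely [F1]. So [F1]
    reaches every vertex, in particular one of [F2], which forces [F1 = F2]. *)
Lemma branch_vertices0_card : branch_vertices C = set0 -> #|C| <= 1.
Proof.
move=> S0; have notS x : x \notin branch_vertices C by rewrite S0 inE.
have cycle_vertex F : F \in C -> exists x, x \in cycle_vertices F.
  move=> /C_decomp.1/andP[/ltnW/card_gt0P[f fF] _].
  have /card_gt0P[x xf] : 0 < #|ends f| by rewrite card_ends.
  by exists x; apply: mem_cycle_vertices fF xf.
apply/card_le1_eqP => F1 F2 F1C F2C.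
have [x xF1] := cycle_vertex F1 F1C; have [y yF2] := cycle_vertex F2 F2C.
apply: (notin_branch (notS y)) => //.
apply: (connected_closed G_connected xF1) => e u w uF1 ue we.
have [F FC eF] := decomposition_cover e.
have uF := mem_cycle_vertices eF ue.
rewrite (notin_branch (notS u) F1C FC uF1 uF).
exact: mem_cycle_vertices eF we.
Qed.

Lemma branch_vertices_decycling :
  #|C| <> 1 -> decycling_set (branch_vertices C).
Proof.
move=> C_not1; apply/forallP => F; apply/negP => F_cycle.
have := branch_vertices0_card (surviving_cycle_no_branch F F_cycle).
(* The value 1 is excluded by hypothesis, and 0 because some member of [C] contains an edge of the
   surviving cycle. *)
rewrite leq_eqVlt => /orP[/eqP //|]; apply/negP; rewrite -leqNgt card_gt0.
have /andP[/ltnW/card_gt0P[f _] _] := F_cycle.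
have [F' F'C _] := decomposition_cover (val f).
by apply/set0Pn; exists F'.
Qed.

End Decomposition.

(** A single cycle has to be excluded: [G] is then a cycle, with decycling number 1, whereas CI(G)
    has no edge. *)
Theorem theorem1 (G : mgraph) (C : {set {set edge G}})
  (G_connected : connected G) (G_even : even_graph G)
  (C_decomp : cycle_decomposition C)
  (C_not_single : #|C| <> 1) :
  decycling_number G <= #|edge (cycle_intersection_graph C)|.
Proof.
apply: leq_trans (card_branch_vertices _ C).
rewrite /decycling_number; case: arg_minnP => [|S _]; first exact: decycling_setT.
by apply; apply: branch_vertices_decycling.
Qed.
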